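(* Let $\varphi\colon\mathbb{R}\to[0,+\infty]$ be a lower semicontinuous convex function with nonempty domain included in $[0,+\infty[$ and such that $\varphi(1)=0$. Let $\lambda_0\in\,]0,+\infty[$ and let $\alpha\colon\mathbb{R}^N\to\mathbb{R}\cup\{+\infty\}$ be given by $$\alpha(q)=\begin{cases}\lambda_0 D_\varphi(q,p)&\text{if } q\in\mathcal{M}_1,\\ +\infty&\text{otherwise.}\end{cases}$$ Then the problem of finding $$\overline{\theta}\in\operatorname*{arg\,min}_{\theta\in\mathbb{R}^n}\ \sup_{q\in\mathcal{M}_1}\Big(\sum_{i=1}^N q_i\,\ell(\theta,z_i)-\alpha(q)\Big)$$ is equivalent to (i.e. has the same set of solutions $\overline{\theta}$ as) finding $$\overline{\theta}\in\operatorname*{arg\,min}_{\theta\in\mathbb{R}^n}\ \min_{\mu\in\mathbb{R}}\ g(\theta,\mu),$$ where $g$ is the proper, lower semicontinuous, convex function given, for every $\theta\in\mathbb{R}^n$ and $\mu\in\mathbb{R}$, by $$g(\theta,\mu)=\mu+\sum_{i=1}^N p_i\,\varphi^*\Big(\frac{\ell(\theta,z_i)}{\lambda_0}-\mu\Big).$$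
   Context: Setting. $\Omega=\{\omega_1,\dots,\omega_N\}$ is a finite set of cardinality $N\ge 1$ with a probability distribution $p=(p_i)_{1\le i\le N}$ charging all points ($p_i>0$ for every $i$). $\mathcal{M}_1$ is the set of probability distributions on $\Omega$, identified with $\{q\in\mathbb{R}^N\mid q_i\ge 0\text{ for all }i,\ \sum_{i=1}^N q_i=1\}$. Let $d,n\ge 1$ be integers and let $z_1,\dots,z_N\in\mathbb{R}^d$ be the values of a random variable $\mathbf{z}\colon\Omega\to\mathbb{R}^d$. For every $i\in\{1,\dots,N\}$, $\ell(\cdot,z_i)\colon\mathbb{R}^n\to\mathbb{R}\cup\{+\infty\}$ is a lower semicontinuous convex function, and $\bigcap_{i=1}^N\operatorname{dom}\ell(\cdot,z_i)\ne\varnothing$. The domain of a function is the set of points at which it is finite. The conjugate of $\varphi$ is $\varphi^*(s)=\sup_{t\in\mathbb{R}}(st-\varphi(t))$ for $s\in\mathbb{R}$. The $\varphi$-divergence $D_\varphi\colon\mathbb{R}^N\times\mathbb{R}^N\to[0,+\infty]$ is $D_\varphi(a,b)=\sum_{i=1}^N\underline{f_\varphi}(a_i,b_i)$, where $$\underline{f_\varphi}(x,\xi)=\begin{cases}\xi\,\varphi(x/\xi)&\text{if }\xi>0\text{ and }x\ge 0,\\ x\lim_{t\to+\infty}\varphi(t)/t&\text{if }\xi=0\text{ and }x>0,\\ 0&\text{if }\xi=0\text{ and }x=0,\\ +\infty&\text{otherwise.}\end{cases}$$ In particular, since $p_i>0$ for all $i$, $D_\varphi(q,p)=\sum_{i=1}^N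 p_i\varphi(q_i/p_i)$ for $q\in\mathcal{M}_1$. Conventions for infinite losses: $0\cdot(+\infty)=0$; the supremum over $q$ is effectively over $q\in\operatorname{dom}\alpha$ (other terms count as $-\infty$); and $\varphi^*(+\infty)=+\infty$. These play no role if all losses are finite-valued. *)

(* Defs.v *)
From HB Require Import structures.
From mathcomp Require Import all_boot all_order all_algebra.
From mathcomp Require Import all_classical all_reals all_analysis.

Set Implicit Arguments.
Unset Strict Implicit.
Unset Printing Implicit Defensive.

Import Order.TTheory GRing.Theory Num.Theory.
Import numFieldNormedType.Exports.

Local Open Scope classical_set_scope.
Local Open Scope ring_scope.

Definition effective_domain (R : realType) (T : Type) (f : T -> \bar R) :
    set T :=
  [set x | f x \is a fin_num].

Definition proper_efun (R : realType) (T : Type) (f : T -> \bar R) : Prop :=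
  (forall x, f x != -oo%E) /\ effective_domain f !=set0.

(* Meant for functions that do not take the value -oo. The library's
   convex_function only covers real-valued functions. *)
Definition convex_efun (R : realType) (E : lmodType R) (f : E -> \bar R) :
    Prop :=
  forall (x y : E) (t : R), 0 < t -> t < 1 ->
    (f (t *: x + (1 - t) *: y)%R <= t%:E * f x + (1 - t)%:E * f y)%E.

Definition argmin (R : realType) (T : Type) (f : T -> \bar R) : set T :=
  [set x | forall y, (f x <= f y)%E].

Definition prob_simplex (R : realType) (N : nat) : set 'rV[R]_N :=
  [set q | (forall i, 0 <= q 0 i) /\ \sum_i q 0 i = 1].
Arguments prob_simplex : clear implicits.

Definition conjugate (R : realType) (phi : R -> \bar R) (s : R) : \bar R :=
  ereal_sup [set ((s * t)%:E - phi t)%E | t in [set: R]].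

(* Extension to infinite arguments by phi^*(+oo) = +oo. The value at -oo is
   never used: the losses do not take the value -oo. *)
Definition conjugate_ext (R : realType) (phi : R -> \bar R) (s : \bar R) :
    \bar R :=
  if s is r%:E then conjugate phi r else s.

(* Lower semicontinuous envelope of the perspective function of phi. *)
Definition perspective (R : realType) (phi : R -> \bar R) (x xi : R) : \bar R :=
  if (0 < xi) && (0 <= x) then (xi%:E * phi (x / xi)%R)%E
  else if (xi == 0) && (0 < x) then
    (x%:E * lim ((phi t * (t^-1)%:E)%E @[t --> +oo%R]))%E
  else if (xi == 0) && (x == 0) then 0%E
  else +oo%E.

Definition phi_divergence (R : realType) (N : nat) (phi : R -> \bar R)
    (a b : 'rV[R]_N) : \bar R :=
  (\sum_i perspective phi (a 0%R i) (b 0%R i))%E.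

Definition divergence_penalty (R : realType) (N : nat) (phi : R -> \bar R)
    (lambda0 : R) (p q : 'rV[R]_N) : \bar R :=
  if q \in prob_simplex R N then (lambda0%:E * phi_divergence phi q p)%E
  else +oo%E.

(* The conventions for infinite losses are those of \bar R: 0 * +oo = 0, and
   +oo - +oo = -oo, so that any q with alpha q = +oo contributes -oo to the
   supremum. *)
Definition robust_loss (R : realType) (N n d : nat)
    (loss : 'rV[R]_n -> 'rV[R]_d -> \bar R) (z : 'I_N -> 'rV[R]_d)
    (alpha : 'rV[R]_N -> \bar R) (theta : 'rV[R]_n) : \bar R :=
  ereal_sup [set (\sum_i (q 0%R i)%:E * loss theta (z i) - alpha q)%E
            | q in prob_simplex R N].

Definition dual_loss (R : realType) (N n d : nat) (phi : R -> \bar R)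
    (lambda0 : R) (p : 'rV[R]_N)
    (loss : 'rV[R]_n -> 'rV[R]_d -> \bar R) (z : 'I_N -> 'rV[R]_d)
    (theta : 'rV[R]_n) (mu : R) : \bar R :=
  (mu%:E + \sum_i (p 0%R i)%:E *
     conjugate_ext phi (loss theta (z i) / lambda0%:E - mu%:E))%E.

(* Main.v *)
Require Import Defs.
From mathcomp Require Import all_boot all_order all_algebra.
From mathcomp Require Import ring lra.
From mathcomp Require Import all_classical all_reals all_analysis.

Set Implicit Arguments.
Unset Strict Implicit.
Unset Printing Implicit Defensive.

Import Order.TTheory GRing.Theory Num.Theory.
Import numFieldNormedType.Exports.

Local Open Scope classical_set_scope.
Local Open Scope ring_scope.

(** The statement is Lagrangian duality for the single constraint that the
    weights of q sum to 1.  Put D = dom phi, f = phi on D and q_i = p_i t_i.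
    For a parameter theta at which all losses are finite, write
    a_i = loss theta (z i) / lambda0.  The robust loss divided by lambda0 is

      sup { sum_i p_i (t_i a_i - f (t_i)) | t in D^N, sum_i p_i t_i = 1 },

    and penalizing the constraint with a multiplier mu and then maximizing over
    each t_i separately turns it into

      mu + sum_i p_i sup_(t in D) (t (a_i - mu) - f t) = g theta mu.

    Weak duality, robust theta <= lambda0 * g theta mu for every mu, is
    immediate ([robust_loss_le_dual]).  For the converse, one mu must achieve
    equality.  View the supremum above as a function V of the value s of the
    constraint sum_i p_i t_i = s.  It is concave, and if V(1) is finite, mu is
    a supergradient of V at s = 1; if V(1) = +oo there is nothing to prove.
    When D has points on both sides of 1, the supremum of the
    slopes of V to the right of 1 is finite and is such a mu.  When 1 is an
    end point of D, the only feasible point is t = 1, and every mu lying on the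
    same side of all the a_i as D lies of 1 will do, because 1 is then the maximizer over D of
    t (a_i - mu) - f t ([exists_multiplier]).  Exchanging the sum with the
    suprema over the individual t_i ([sum_ereal_sup_le]) gives a mu with
    lambda0 * g theta mu <= robust theta ([dual_le_robust_loss]).  If some
    loss is infinite, the choice q = p makes the robust loss infinite, so that
    every mu satisfies this inequality.

    Hence g theta attains its infimum, and the robust loss is lambda0 times
    this infimum, at every theta: the two problems have the same minimizers.

    Properness, lower semicontinuity and convexity of g come from one formula:
    since D contains only nonnegative numbers and contains 1, the conjugate at
    any x <> -oo, including x = +oo, is the supremum over t in D of t x - phi t
    ([conjugate_extE]).  So g is built from the losses and from real
    affine functions of mu by nonnegative combinations and suprema, which
    preserve convexity and lower semicontinuity. *)

(** * Sums of extended reals that avoid -oo *)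

Lemma sume_neqNy (R : realType) (I : Type) (s : seq I) (f : I -> \bar R) :
  (forall i, f i != -oo%E) -> (\sum_(i <- s) f i != -oo)%E.
Proof.
move=> fNy; elim: s => [|i s IH]; first by rewrite big_nil.
by rewrite big_cons adde_eq_ninfty negb_or fNy.
Qed.

Lemma mule_neqNy (R : realType) (c : R) (x : \bar R) :
  0 <= c -> x != -oo%E -> (c%:E * x != -oo)%E.
Proof.
move=> c0; case: x => [r| |] //= _; rewrite mulry.
by case: (sgrP c) c0 => //=; rewrite ?mul0e ?mul1e.
Qed.

(** This reduces lower semicontinuity of a sum to that of its two terms: a
    strict lower bound on the sum is shared out between the terms. *)
Lemma lte_splitD (R : realType) (a : R) (x y : \bar R) :
  x != -oo%E -> y != -oo%E -> (a%:E < x + y)%E ->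
  exists b c : R, [/\ (b%:E < x)%E, (c%:E < y)%E & a <= b + c].
Proof.
case: x => [x| |] //; case: y => [y| |] // _ _.
- rewrite -EFinD lte_fin => axy; exists (x - (x + y - a) / 2), (y - (x + y - a) / 2).
  by rewrite !lte_fin; split; lra.
- by move=> _; exists (x - 1), (a - (x - 1)); rewrite lte_fin ltry; split => //; lra.
- by move=> _; exists (a - (y - 1)), (y - 1); rewrite lte_fin ltry; split => //; lra.
- by move=> _; exists a, 0; rewrite !ltry addr0.
Qed.

(** * Operations preserving lower semicontinuity *)

Section semicontinuity.
Context (R : realType) (X : topologicalType).
Implicit Types f g : X -> \bar R.

Lemma lsc_comp (Y : topologicalType) (h : X -> Y) (f : Y -> \bar R) :
  continuous h -> lower_semicontinuous f -> lower_semicontinuous (f \o h).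
Proof.
move=> hc /lower_semicontinuousP fl; apply/lower_semicontinuousP => a.
exact: (open_comp (fun x _ => hc x) (fl a)).
Qed.

Lemma lsc_EFin (h : X -> R) :
  continuous h -> lower_semicontinuous (fun x => (h x)%:E).
Proof.
move=> hc; apply/lower_semicontinuousP => a.
have -> : [set x | (a%:E < (h x)%:E)%E] = h @^-1` [set y | a < y].
  by apply/seteqP; split => x /=; rewrite lte_fin.
by apply: open_comp; [move=> x _; exact: hc | exact: open_gt].
Qed.

Lemma lsc_sup (T : Type) (A : set T) (F : T -> X -> \bar R) :
  (forall t, A t -> lower_semicontinuous (F t)) ->
  lower_semicontinuous (fun x => ereal_sup [set F t x | t in A]).
Proof.
move=> Fl x a /ereal_sup_gt[_ [t At <-] aF].
have [V Vx Va] := Fl t At x a aF; exists V => // y Vy.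
by apply: lt_le_trans (Va y Vy) _; apply: ereal_sup_ubound; exists t.
Qed.

Lemma lscD f g : (forall x, f x != -oo%E) -> (forall x, g x != -oo%E) ->
  lower_semicontinuous f -> lower_semicontinuous g ->
  lower_semicontinuous (fun x => f x + g x)%E.
Proof.
move=> fNy gNy fl gl x a /(lte_splitD (fNy x) (gNy x))[b [c [bf cg abc]]].
have [V Vx Vb] := fl x b bf; have [W Wx Wc] := gl x c cg.
exists (V `&` W); first exact: filterI.
move=> y [Vy Wy]; apply: (@le_lt_trans _ _ (b%:E + c%:E)%E).
  by rewrite -EFinD lee_fin.
by apply: lteD; [exact: Vb | exact: Wc].
Qed.

Lemma lscZ (c : R) f : 0 <= c ->
  lower_semicontinuous f -> lower_semicontinuous (fun x => c%:E * f x)%E.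
Proof.
rewrite le_eqVlt => /predU1P[<- _|c0 fl x a acf].
  under eq_fun do rewrite mul0e.
  by move=> x a a0; exists setT => //; exact: filterT.
have cE r y : (r%:E < c%:E * y)%E = ((r / c)%:E < y)%E.
  by rewrite -lte_pdivrMl// -EFinM mulrC.
move: acf; rewrite cE => /fl[V Vx Va].
by exists V => // y Vy; rewrite cE; exact: Va.
Qed.

Lemma lsc_sum (I : Type) (s : seq I) (F : I -> X -> \bar R) :
  (forall i x, F i x != -oo%E) -> (forall i, lower_semicontinuous (F i)) ->
  lower_semicontinuous (fun x => \sum_(i <- s) F i x)%E.
Proof.
move=> FNy Fl; elim: s => [|i s IH].
  by under eq_fun do rewrite big_nil; apply: lsc_EFin => x; exact: cst_continuous.
under eq_fun do rewrite big_cons.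
by apply: lscD => // x; exact: sume_neqNy.
Qed.

End semicontinuity.

(** * Operations preserving convexity *)

Section convexity.
Context (R : realType) (E : lmodType R).
Implicit Types f g : E -> \bar R.

Lemma convex_efun_sup (T : Type) (A : set T) (F : T -> E -> \bar R) :
  (forall t, A t -> convex_efun (F t)) ->
  convex_efun (fun x => ereal_sup [set F t x | t in A]).
Proof.
move=> Fc x y w w0 w1; apply: ge_ereal_sup => _ [t At <-].
apply: (le_trans (Fc t At x y w w0 w1)).
have Fsup z : (F t z <= ereal_sup [set F t z | t in A])%E.
  by apply: ereal_sup_ubound; exists t.
by apply: leeD; apply: lee_wpmul2l (Fsup _); rewrite lee_fin ?subr_ge0 ltW.
Qed.

Lemma convex_efunD f g :
  (forall x, f x != -oo%E) -> (forall x, g x != -oo%E) ->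
  convex_efun f -> convex_efun g -> convex_efun (fun x => f x + g x)%E.
Proof.
move=> fNy gNy fc gc x y w w0 w1.
have D (c : R) z : (c%:E * (f z + g z) = c%:E * f z + c%:E * g z)%E.
  apply: muleDr => //; rewrite /adde_def.
  by have := fNy z; have := gNy z; case: (f z); case: (g z).
by rewrite !D addeACA; apply: leeD; [exact: fc | exact: gc].
Qed.

Lemma convex_efunZ (c : R) f : 0 <= c -> (forall x, f x != -oo%E) ->
  convex_efun f -> convex_efun (fun x => c%:E * f x)%E.
Proof.
move=> c0 fNy fc x y w w0 w1; rewrite 2!(muleCA _ c%:E) -muleDr//.
  by apply: lee_wpmul2l; [rewrite lee_fin | exact: fc].
have wNy : (w%:E * f x != -oo)%E by rewrite mule_neqNy ?ltW.
have w1Ny : ((1 - w)%:E * f y != -oo)%E by rewrite mule_neqNy ?subr_ge0 ?ltW.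
by rewrite /adde_def (negPf wNy) (negPf w1Ny) !andbF.
Qed.

Lemma convex_efun_sum (I : Type) (s : seq I) (F : I -> E -> \bar R) :
  (forall i x, F i x != -oo%E) -> (forall i, convex_efun (F i)) ->
  convex_efun (fun x => \sum_(i <- s) F i x)%E.
Proof.
move=> FNy Fc; elim: s => [|i s IH].
  by move=> x y w _ _; rewrite !big_nil !mule0 adde0.
under eq_fun do rewrite big_cons.
by apply: convex_efunD => // x; exact: sume_neqNy.
Qed.

End convexity.

(** * A Lagrange multiplier for the normalization constraint *)

Section multiplier.
Context (R : realType) (I : finType).
Variables (p a : I -> R) (D : set R) (f : R -> R).
Hypotheses (p_ge0 : forall i, 0 <= p i) (p_sum1 : \sum_i p i = 1).
Hypothesis f_ge0 : forall t, D t -> 0 <= f t.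
Hypotheses (D1 : D 1) (f1 : f 1 = 0).
Hypothesis D_convex : forall x y w, D x -> D y -> 0 < w -> w < 1 ->
  D (w * x + (1 - w) * y).
Hypothesis f_convex : forall x y w, D x -> D y -> 0 < w -> w < 1 ->
  f (w * x + (1 - w) * y) <= w * f x + (1 - w) * f y.

Let mean (t : I -> R) : R := \sum_i p i * t i.
Let gain (t : I -> R) : R := \sum_i p i * (t i * a i - f (t i)).

Variable v : R.
Hypothesis gain_le : forall t, (forall i, D (t i)) -> mean t = 1 -> gain t <= v.

Lemma lagrangianE (m : R) (t : I -> R) :
  m + \sum_i p i * (t i * (a i - m) - f (t i)) = gain t - m * (mean t - 1).
Proof.
rewrite mulrBr opprB mulr1 addrCA; congr (_ + _).
rewrite /gain /mean mulr_sumr -sumrB.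
by apply: eq_bigr => i _; ring.
Qed.

(** This applies when D lies on one side of 1 and m lies on the same side of all
    the a i.  The constant family 1 maximizes the Lagrangian term by term: replacing t i
    by 1 raises (t i - 1) (a i - m) to 0 and lowers f to its minimum 0. *)
Lemma lagrangian_boundary (m : R) :
  (forall t i, D t -> (t - 1) * (a i - m) <= 0) ->
  forall t, (forall i, D (t i)) -> gain t - m * (mean t - 1) <= v.
Proof.
move=> mP t Dt; apply: (@le_trans _ _ (gain (fun=> 1))); last first.
  apply: gain_le => //.
  by rewrite /mean; under eq_bigr do rewrite mulr1.
have -> : mean t - 1 = \sum_i (p i * t i - p i) by rewrite sumrB p_sum1.
rewrite /gain mulr_sumr -sumrB; apply: ler_sum => i _.
rewrite -subr_ge0 f1.
have -> : p i * (1 * a i - 0) - (p i * (t i * a i - f (t i)) -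
    m * (p i * t i - p i)) = p i * (f (t i) - (t i - 1) * (a i - m)) by ring.
by rewrite mulr_ge0// subr_ge0 (le_trans (mP _ i (Dt i)))// f_ge0.
Qed.

(** The segment from u to t meets the constraint set, where the gain is at most
    v.  As the gain is concave, seen from the point (1, v) the graph cannot rise
    faster towards t on the right than it falls towards u on the left. *)
Lemma slope_le (t u : I -> R) :
  (forall i, D (t i)) -> (forall i, D (u i)) -> 1 < mean t -> mean u < 1 ->
  (gain t - v) / (mean t - 1) <= (v - gain u) / (1 - mean u).
Proof.
move=> Dt Du t1 u1.
have tu : 0 < mean t - mean u by lra.
(* the weight for which the mean of w t + (1 - w) u is 1 *)
pose w := (1 - mean u) / (mean t - mean u).
have w0 : 0 < w by rewrite divr_gt0// subr_gt0.
have w1 : w < 1 by rewrite ltr_pdivrMr//; lra.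
pose c i := w * t i + (1 - w) * u i.
have cE : mean c = 1.
  have -> : mean c = w * mean t + (1 - w) * mean u.
    rewrite /mean !mulr_sumr -big_split; apply: eq_bigr => i _ /=.
    by rewrite /c; ring.
  by rewrite /w; field; lra.
have cv : gain c <= v by apply: gain_le => // i; exact: D_convex.
have gc : w * gain t + (1 - w) * gain u <= gain c.
  rewrite /gain !mulr_sumr -big_split; apply: ler_sum => i _ /=.
  have := ler_wpM2l (p_ge0 i) (f_convex (Dt i) (Du i) w0 w1).
  rewrite -subr_ge0 => h; rewrite -subr_ge0; move: h.
  by congr (_ <= _); rewrite /c; ring.
rewrite ler_pdivrMr ?subr_gt0// mulrAC ler_pdivlMr ?subr_gt0//.
have wE : w * (mean t - mean u) = 1 - mean u by rewrite /w; field; lra.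
have := le_trans gc cv; rewrite -(ler_pM2r tu).
have -> : (w * gain t + (1 - w) * gain u) * (mean t - mean u) =
  (w * (mean t - mean u)) * gain t +
  ((mean t - mean u) - w * (mean t - mean u)) * gain u by ring.
by rewrite wE; nra.
Qed.

(** The line of slope m through (1, v) lies above the concave function that
    sends s to the supremum of the gains of the t with mean s. *)
Lemma exists_multiplier : exists m : R, forall t, (forall i, D (t i)) ->
  m + \sum_i p i * (t i * (a i - m) - f (t i)) <= v.
Proof.
suff [m mP] : exists m : R, forall t, (forall i, D (t i)) ->
    gain t - m * (mean t - 1) <= v.
  by exists m => t Dt; rewrite lagrangianE; exact: mP.
pose M := \sum_i `|a i|.
have aM i : `|a i| <= M.
  by rewrite /M (bigD1 i)//= lerDl sumr_ge0.
have [[x [Dx x1]]|Dle1] := pselect (exists x, D x /\ 1 < x); last first.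
  exists (- M); apply: lagrangian_boundary => t i Dt.
  have t1 : t <= 1 by rewrite leNgt; apply/negP => t1; apply: Dle1; exists t.
  by have := aM i; rewrite ler_norml => /andP[]; nra.
have [[y [Dy y1]]|Dge1] := pselect (exists x, D x /\ x < 1); last first.
  exists M; apply: lagrangian_boundary => t i Dt.
  have t1 : 1 <= t by rewrite leNgt; apply/negP => t1; apply: Dge1; exists t.
  by have := aM i; rewrite ler_norml => /andP[]; nra.
have mean_cst (r : R) : mean (fun=> r) = r by rewrite /mean -mulr_suml p_sum1 mul1r.
(* D extends on both sides of 1: m is the supremum of slopes right of 1 *)
pose S := [set (gain t - v) / (mean t - 1) | t in
  [set t | (forall i, D (t i)) /\ 1 < mean t]].
have ubS (u : I -> R) : (forall i, D (u i)) -> mean u < 1 ->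
    ubound S ((v - gain u) / (1 - mean u)).
  by move=> Du u1 _ [t [Dt t1] <-]; exact: slope_le.
have S0 : S !=set0.
  exists ((gain (fun=> x) - v) / (mean (fun=> x) - 1)), (fun=> x) => //=.
  by rewrite mean_cst.
exists (sup S) => t Dt; have [t1|t1|t1] := ltgtP (mean t) 1.
- have : sup S <= (v - gain t) / (1 - mean t) by apply: ge_sup => //; exact: ubS.
  by rewrite ler_pdivlMr ?subr_gt0//; lra.
- have : (gain t - v) / (mean t - 1) <= sup S.
    apply: ub_le_sup; last by exists t.
    by exists ((v - gain (fun=> y)) / (1 - mean (fun=> y))); apply: ubS; rewrite ?mean_cst.
  by rewrite ler_pdivrMr ?subr_gt0//; lra.
- by rewrite t1 subrr mulr0 subr0; exact: gain_le.
Qed.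

End multiplier.

(** The t i vary independently, so maximizing the sum amounts to maximizing
    each term.  The real bound v makes every supremum finite, after which
    near-maximizers can be chosen for all i at once. *)
Lemma sum_ereal_sup_le (R : realType) (I : finType) (p : I -> R) (D : set R)
    (h : I -> R -> R) (v : R) :
  (forall i, 0 < p i) -> \sum_i p i = 1 -> D !=set0 ->
  (forall t : I -> R, (forall i, D (t i)) -> \sum_i p i * h i (t i) <= v) ->
  (\sum_i (p i)%:E * ereal_sup [set (h i t)%:E | t in D] <= v%:E)%E.
Proof.
move=> p0 p1 [t0 Dt0] hv.
pose S i := ereal_sup [set (h i t)%:E | t in D].
have Sfin i : S i \is a fin_num.
  rewrite fin_numE; apply/andP; split.
    apply/eqP => SNy.
    have : ((h i t0)%:E <= S i)%E by apply: ereal_sup_ubound; exists t0.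
    by rewrite SNy.
  rewrite -ltey; apply: (@le_lt_trans _ _
    ((v - \sum_(j | j != i) p j * h j t0) / p i)%:E); last exact: ltry.
  apply: ge_ereal_sup => _ [t Dt <-]; rewrite lee_fin ler_pdivlMr// lerBrDr.
  (* varying a single coordinate bounds the i-th supremum *)
  have := hv (fun j => if j == i then t else t0) _.
  rewrite (bigD1 i)//= eqxx mulrC => H.
  rewrite (@eq_bigr _ _ _ _ _ (fun j => j != i) (fun j => p j * h j t0)
    (fun j => p j * h j (if j == i then t else t0))).
    by apply: H => j; case: ifP.
  by move=> j /negPf ->.
have -> : (\sum_i (p i)%:E * S i)%E = (\sum_i p i * fine (S i))%:E.
  by rewrite -sumEFin; apply: eq_bigr => i _; rewrite EFinM fineK.
rewrite lee_fin; apply/ler_addgt0Pr => e e0.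
have /choice[t tP] i : exists t, D t /\ fine (S i) - e < h i t.
  have [_ [t Dt <-]] := ub_ereal_sup_adherent e0 (Sfin i).
  by rewrite -/(S i) -(fineK (Sfin i)) -EFinB lte_fin => ?; exists t.
have := hv t (fun i => (tP i).1); rewrite -lerBlDr; apply: le_trans.
rewrite -[e]mul1r -p1 mulr_suml -sumrB; apply: ler_sum => i _.
by rewrite -mulrBr ler_wpM2l// ltW//; [exact: (tP i).2].
Qed.

(** * The conjugate as a supremum over the domain *)

Section penalized_risk.
Context (R : realType) (phi : R -> \bar R).
Hypotheses (phi_ge0 : forall t, (0 <= phi t)%E) (phi_convex : convex_efun phi).
Hypothesis phi_dom : effective_domain phi `<=` [set t | 0 <= t].
Hypothesis phi1 : phi 1 = 0%E.

Let D := effective_domain phi.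
Let f t := fine (phi t).

Let D1 : D 1. Proof. by rewrite /D /effective_domain /= phi1. Qed.

Let phiE t : D t -> phi t = (f t)%:E.
Proof. by move=> Dt; rewrite /f fineK. Qed.

Let phiNdom t : ~ D t -> phi t = +oo%E.
Proof.
rewrite /D /effective_domain /=; have := phi_ge0 t.
by case: (phi t) => [r| |] //= _ /(_ isT).
Qed.

Let f_ge0 t : D t -> 0 <= f t. Proof. by move=> _; exact: fine_ge0. Qed.

Let f_convexD x y w : D x -> D y -> 0 < w -> w < 1 ->
  D (w * x + (1 - w) * y) /\ f (w * x + (1 - w) * y) <= w * f x + (1 - w) * f y.
Proof.
move=> Dx Dy w0 w1; have := phi_convex x y w0 w1.
rewrite (phiE Dx) (phiE Dy) -!EFinM -EFinD => le.
have Dz : D (w * x + (1 - w) * y).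
  apply: contrapT => /phiNdom zy; move: le.
  by rewrite [phi _]zy leye_eq.
by split=> //; move: le; rewrite [phi _](phiE Dz) lee_fin.
Qed.

(** At x = +oo the convention phi^*(+oo) = +oo agrees with the supremum because
    t = 1 has phi 1 = 0. *)
Lemma conjugate_extE (x : \bar R) : x != -oo%E ->
  conjugate_ext phi x = ereal_sup [set (t%:E * x - phi t)%E | t in D].
Proof.
case: x => [r| |] //= _; last first.
  apply/esym/eqP; rewrite -leye_eq; apply: ereal_sup_ubound.
  by exists 1 => //; rewrite phi1 mul1e sube0.
apply/eqP; rewrite eq_le; apply/andP; split; apply: ge_ereal_sup => _ [t Dt <-].
  have [{}Dt|/phiNdom ->] := pselect (D t); last by rewrite addeC leNye.
  by apply: ereal_sup_ubound; exists t; rewrite // -EFinM mulrC.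
by apply: ereal_sup_ubound; exists t; rewrite // -EFinM mulrC.
Qed.

Lemma conjugate_ext_ge (x : \bar R) : x != -oo%E -> (x <= conjugate_ext phi x)%E.
Proof.
move=> xNy; rewrite conjugate_extE//; apply: ereal_sup_ubound.
by exists 1 => //; rewrite phi1 mul1e sube0.
Qed.

Lemma conjugate_ext_neqNy (x : \bar R) : x != -oo%E -> conjugate_ext phi x != -oo%E.
Proof.
move=> xNy; have := conjugate_ext_ge xNy; apply: contraTneq => ->.
by rewrite leeNy_eq.
Qed.

(** On the nonpositive half-line the conjugate is at most 0, since D contains
    only nonnegative numbers and phi >= 0. *)
Lemma conjugate_fin_num (s : R) : s <= 0 -> conjugate phi s \is a fin_num.
Proof.
move=> s0; rewrite fin_numE (conjugate_ext_neqNy (x := s%:E))//= -ltey.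
apply: (@le_lt_trans _ _ 0%E) => //.
rewrite -[conjugate phi s]/(conjugate_ext phi s%:E) conjugate_extE//.
apply: ge_ereal_sup => _ [t Dt <-]; rewrite (phiE Dt) -EFinM -EFinB lee_fin.
have := f_ge0 Dt; have := phi_dom Dt; rewrite /=.
by nra.
Qed.

(** * Regularity of the dual function *)

Section dual_function.
Context (N n d : nat) (p : 'rV[R]_N) (loss : 'rV[R]_n -> 'rV[R]_d -> \bar R).
Variables (z : 'I_N -> 'rV[R]_d) (lambda0 : R).
Hypothesis p_gt0 : forall i, 0 < p 0 i.
Hypothesis loss_Ny : forall i theta, loss theta (z i) != -oo%E.
Hypothesis lambda0_gt0 : 0 < lambda0.

Let g := dual_loss phi lambda0 p loss z.

Let divE (x : \bar R) : (x / lambda0%:E = (lambda0^-1)%:E * x)%E.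
Proof. by rewrite inver gt_eqF// muleC. Qed.

Let argNy i theta (mu : R) : (loss theta (z i) / lambda0%:E - mu%:E != -oo)%E.
Proof.
rewrite divE adde_eq_ninfty negb_or andbT mule_neqNy// ltW//.
by rewrite invr_gt0.
Qed.

Let termNy i theta (mu : R) : ((p 0 i)%:E *
  conjugate_ext phi (loss theta (z i) / lambda0%:E - mu%:E) != -oo)%E.
Proof. by apply: mule_neqNy; [exact: ltW | exact: conjugate_ext_neqNy]. Qed.

Lemma dual_loss_neqNy theta mu : g theta mu != -oo%E.
Proof. by rewrite /g /dual_loss adde_eq_ninfty negb_or sume_neqNy. Qed.

Lemma dual_loss_proper :
  \bigcap_(i in [set: 'I_N])
    effective_domain (fun theta => loss theta (z i)) !=set0 ->
  proper_efun (fun x : 'rV[R]_n * R => g x.1 x.2).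
Proof.
move=> [theta th]; split=> [x|]; first exact: dual_loss_neqNy.
pose a i := fine (loss theta (z i)).
(* mu is at least every a i / lambda0, so the conjugates are at nonpositive points *)
exists (theta, \sum_i `|a i / lambda0|); rewrite /effective_domain/=.
rewrite /g /dual_loss fin_numD/= sum_fin_num; apply/allP => _ /mapP[i _ ->].
rewrite -(fineK (th i I)) -/(a i) inver gt_eqF// -EFinM -EFinB /=.
rewrite fin_numM// conjugate_fin_num// subr_le0 (bigD1 i)//=.
by rewrite (le_trans (ler_norm _))// lerDl sumr_ge0.
Qed.

(** The i-th conjugate as a function of (theta, mu), with the loss separated
    from a real function affine in mu, which makes each member of the supremum
    visibly convex and lower semicontinuous. *)
Let term (i : 'I_N) (x : 'rV[R]_n * R) : \bar R := ereal_sup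
  [set (((t / lambda0)%:E * loss x.1 (z i)) + (- (t * x.2 + f t))%:E)%E | t in D].

Let dual_lossE : (fun x : 'rV[R]_n * R => g x.1 x.2) =
  (fun x => x.2%:E + \sum_i (p 0%R i)%:E * term i x)%E.
Proof.
apply/funext => x; rewrite /g /dual_loss; congr (_ + _)%E.
apply: eq_bigr => i _; congr (_ * _)%E.
rewrite conjugate_extE// /term; congr ereal_sup; apply: eq_imagel => t Dt.
rewrite (phiE Dt) divE muleBr//; last by rewrite /adde_def !andbF.
rewrite muleA -EFinM opprD EFinD addeA; congr (_ + _)%E.
Qed.

Let term_neqNy i x : term i x != -oo%E.
Proof.
apply: contraTneq (loss_Ny i x.1) => tNy; rewrite negbK.
have : ((1 / lambda0)%:E * loss x.1 (z i) + (- (1 * x.2 + f 1))%:E <= term i x)%E.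
  by apply: ereal_sup_ubound; exists 1.
rewrite tNy leeNy_eq adde_eq_ninfty orbF; apply: contraTT => lNy.
by rewrite mule_neqNy// divr_ge0// ltW.
Qed.

Let pterm_neqNy i x : ((p 0 i)%:E * term i x != -oo)%E.
Proof. by apply: mule_neqNy; first exact: ltW. Qed.

Lemma dual_loss_lsc :
  (forall i, lower_semicontinuous (fun theta => loss theta (z i))) ->
  lower_semicontinuous (fun x : 'rV[R]_n * R => g x.1 x.2).
Proof.
move=> loss_lsc; rewrite dual_lossE; apply: lscD => [//|x||].
- exact: sume_neqNy.
- by apply: lsc_EFin => x; exact: cvg_snd.
apply: lsc_sum => // i; apply: lscZ; first exact: ltW.
apply: lsc_sup => t Dt; have t0 : 0 <= t / lambda0.
  exact: divr_ge0 (phi_dom Dt) (ltW lambda0_gt0).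
apply: lscD => [x|//||].
- exact: mule_neqNy.
- apply: lscZ => //; apply: (lsc_comp (h := fst) _ (loss_lsc i)) => x.
  exact: cvg_fst.
- apply: lsc_EFin => x; apply: cvgN; apply: cvgD; last exact: cvg_cst.
  by apply: cvgM; [exact: cvg_cst | exact: cvg_snd].
Qed.

Lemma dual_loss_convex :
  (forall i, convex_efun (fun theta => loss theta (z i))) ->
  convex_efun (fun x : 'rV[R]_n * R => g x.1 x.2).
Proof.
move=> loss_convex; rewrite dual_lossE; apply: convex_efunD => [//|x||].
- exact: sume_neqNy.
- by move=> x y w _ _ /=; rewrite -!EFinM -EFinD.
apply: convex_efun_sum => // i; apply: convex_efunZ => //; first exact: ltW.
apply: convex_efun_sup => t Dt; have t0 : 0 <= t / lambda0.
  exact: divr_ge0 (phi_dom Dt) (ltW lambda0_gt0).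
apply: convex_efunD => [x|//||].
- exact: mule_neqNy.
- by apply: convex_efunZ => // x y w; exact: loss_convex.
- move=> x y w _ _ /=; rewrite -!EFinM -EFinD lee_fin le_eqVlt.
  apply/orP; left; apply/eqP; rewrite /GRing.scale /=; ring.
Qed.

(** * Strong duality at a fixed parameter *)

Hypothesis p_sum1 : \sum_i p 0%R i = 1.

Let robust := robust_loss loss z (divergence_penalty phi lambda0 p).

(** Only the branch xi > 0 of the perspective function occurs, as p charges all
    points. *)
Lemma divergence_penaltyE (q : 'rV[R]_N) : prob_simplex R N q ->
  divergence_penalty phi lambda0 p q =
  (lambda0%:E * \sum_i (p 0%R i)%:E * phi (q 0%R i / p 0%R i)%R)%E.
Proof.
move=> Sq; rewrite /divergence_penalty mem_set//; congr (_ * _)%E.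
by apply: eq_bigr => i _; rewrite /perspective p_gt0 (Sq.1 i).
Qed.

Let loss_infinite i theta :
  ~ (loss theta (z i) \is a fin_num) -> loss theta (z i) = +oo%E.
Proof. by have := loss_Ny i theta; case: (loss _ _). Qed.

(** Weak duality: bound each conjugate from below by its member at
    t i = q i / p i; the terms in mu cancel because p and q have the same
    mass. *)
Lemma robust_loss_le_dual theta mu :
  (robust theta <= lambda0%:E * g theta mu)%E.
Proof.
apply: ge_ereal_sup => _ [q Sq <-]; rewrite divergence_penaltyE//.
pose t i := q 0%R i / p 0%R i.
have qE i : q 0%R i = p 0%R i * t i by rewrite /t mulrCA divff ?mulr1// gt_eqF.
have [Dt|] := pselect (forall i, D (t i)); last first.
  move/existsNP => [i /phiNdom ti].
  suff -> : (\sum_i (p 0%R i)%:E * phi (q 0%R i / p 0%R i)%R = +oo)%E.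
    by rewrite gt0_muley// ?lte_fin//= addeC leNye.
  apply/eqP; rewrite esum_eqy => [|j _].
    by apply/existsP; exists i; rewrite /= -/(t i) ti gt0_muley// lte_fin.
  apply: mule_neqNy; first exact: ltW.
  by have := phi_ge0 (q 0%R j / p 0%R j); case: (phi _).
have [lfin|] := pselect (forall i, loss theta (z i) \is a fin_num); last first.
  move/existsNP => [i li].
  have {}li := loss_infinite li.
  suff -> : g theta mu = +oo%E by rewrite gt0_muley ?lte_fin// leey.
  rewrite /g /dual_loss (_ : (\sum_i _ = +oo)%E)//; apply/eqP.
  rewrite esum_eqy => [|j _]; last exact: termNy.
  apply/existsP; exists i; rewrite /= li divE gt0_muley ?lte_fin ?invr_gt0//=.
  by rewrite gt0_muley ?lte_fin.
pose a i := fine (loss theta (z i)).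
have aE i : loss theta (z i) = (a i)%:E by rewrite /a fineK.
apply: (@le_trans _ _ (lambda0%:E * (mu%:E + \sum_i (p 0%R i)%:E *
    (t i * (a i / lambda0 - mu) - f (t i))%:E))%E); last first.
  apply: lee_wpmul2l; first by rewrite lee_fin ltW.
  apply: leeD => //; apply: lee_sum => i _.
  apply: lee_wpmul2l; first by rewrite lee_fin ltW.
  rewrite conjugate_extE//; apply: ereal_sup_ubound; exists (t i) => //.
  by rewrite aE inver gt_eqF// phiE.
under eq_bigr do rewrite aE -EFinM.
under [X in (_ - _ * X)%E]eq_bigr do rewrite -/(t _) phiE// -EFinM.
under [X in (_ <= _ * (_ + X))%E]eq_bigr do rewrite -EFinM.
rewrite !sumEFin -EFinM -EFinB -EFinD -EFinM lee_fin le_eqVlt; apply/orP; left.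
have {1}-> : mu = \sum_i p 0%R i * mu by rewrite -mulr_suml p_sum1 mul1r.
have -> : \sum_i p 0%R i * mu = \sum_i q 0%R i * mu.
  by rewrite -!mulr_suml p_sum1 Sq.2.
rewrite -big_split !mulr_sumr -sumrB; apply/eqP/eq_bigr => i _ /=.
by rewrite qE; field; rewrite gt_eqF.
Qed.

(** Strong duality together with attainment: the multiplier of
    [exists_multiplier] for v = robust theta / lambda0. *)
Lemma dual_le_robust_loss theta :
  exists mu, (lambda0%:E * g theta mu <= robust theta)%E.
Proof.
have Sp : prob_simplex R N p by split=> // i; exact: ltW.
have term_le q : prob_simplex R N q ->
  (\sum_i (q 0%R i)%:E * loss theta (z i) - divergence_penalty phi lambda0 p q
    <= robust theta)%E.
  by move=> Sq; apply: ereal_sup_ubound; exists q.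
(* the feasible choice q = p, whose penalty is 0 *)
have mean_le : (\sum_i (p 0%R i)%:E * loss theta (z i) <= robust theta)%E.
  have := term_le p Sp; rewrite divergence_penaltyE//.
  rewrite [X in (_ * X)%E]big1 ?mule0 ?sube0//.
  by move=> i _; rewrite divff ?gt_eqF// phi1 mule0.
have [lfin|] := pselect (forall i, loss theta (z i) \is a fin_num); last first.
  move/existsNP => [i li].
  have {}li := loss_infinite li.
  exists 0; apply: le_trans (leey _) _; apply: le_trans mean_le.
  rewrite leye_eq esum_eqy => [|j _].
    by apply/existsP; exists i; rewrite /= li gt0_muley// lte_fin.
  by apply: mule_neqNy => //; exact: ltW.
pose a i := fine (loss theta (z i)).
have aE i : loss theta (z i) = (a i)%:E by rewrite /a fineK.
case: (robust theta) term_le mean_le => [r| |] term_le mean_le; last first.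
- move: mean_le; under eq_bigr do rewrite aE -EFinM.
  by rewrite sumEFin.
- by exists 0; rewrite leey.
have [|t Dt t1|mu muP] := @exists_multiplier R _ (p 0) (fun i => a i / lambda0) D f
    (fun i => ltW (p_gt0 i)) p_sum1 f_ge0 D1 _
    (fun x y w Dx Dy w0 w1 => (f_convexD Dx Dy w0 w1).1)
    (fun x y w Dx Dy w0 w1 => (f_convexD Dx Dy w0 w1).2) (r / lambda0) _.
- by rewrite /f phi1.
- pose q : 'rV[R]_N := \row_i (p 0%R i * t i).
  have Sq : prob_simplex R N q.
    split=> [i|]; first by rewrite mxE; exact: mulr_ge0 (ltW (p_gt0 i)) (phi_dom (Dt i)).
    by under eq_bigr do rewrite mxE.
  have := term_le q Sq; rewrite divergence_penaltyE//.
  under eq_bigr do rewrite aE mxE -EFinM.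
  under [X in (_ - _ * X)%E]eq_bigr => i _ do
    rewrite mxE mulrAC divff ?gt_eqF// mul1r phiE// -EFinM.
  rewrite !sumEFin -EFinM -EFinB lee_fin => le.
  rewrite ler_pdivlMr//; apply: le_trans le; rewrite le_eqVlt; apply/orP; left.
  rewrite mulr_suml mulr_sumr -sumrB; apply/eqP/eq_bigr => i _.
  by field; rewrite gt_eqF.
exists mu; rewrite -lee_pdivlMl// -EFinM mulrC /g /dual_loss.
rewrite addeC -leeBrDr// -EFinB.
under eq_bigr => i _ do rewrite conjugate_extE//.
have -> : (\sum_i (p 0%R i)%:E * ereal_sup [set (t%:E *
      (loss theta (z i) / lambda0%:E - mu%:E) - phi t)%E | t in D] =
    \sum_i (p 0%R i)%:E * ereal_sup [set
      (t * (a i / lambda0 - mu) - f t)%:E | t in D])%E.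
  apply: eq_bigr => i _; congr (_ * ereal_sup _)%E; apply: eq_imagel => t Dt.
  by rewrite aE inver gt_eqF// phiE.
apply: sum_ereal_sup_le => //; first by exists 1.
by move=> t Dt; rewrite lerBrDl; exact: muP.
Qed.

Lemma dual_loss_argmin theta : argmin (g theta) !=set0.
Proof.
have [mu muP] := dual_le_robust_loss theta; exists mu => nu.
have := le_trans muP (robust_loss_le_dual theta nu).
by rewrite lee_pmul2l// lte_fin.
Qed.

Lemma robust_lossE theta :
  robust theta = (lambda0%:E * ereal_inf (range (g theta)))%E.
Proof.
have [mu muP] := dual_le_robust_loss theta.
have -> : ereal_inf (range (g theta)) = g theta mu.
  apply/eqP; rewrite eq_le; apply/andP; split.
    by apply: ereal_inf_lbound; exists mu.
  apply: le_ereal_inf_tmp => _ [nu _ <-].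
  have := le_trans muP (robust_loss_le_dual theta nu).
  by rewrite lee_pmul2l// lte_fin.
by apply/eqP; rewrite eq_le muP robust_loss_le_dual.
Qed.

Lemma argmin_robust_loss :
  argmin robust = argmin (fun theta => ereal_inf (range (g theta))).
Proof.
apply/seteqP; split=> theta /= min nu; have := min nu;
  by rewrite !robust_lossE lee_pmul2l// lte_fin.
Qed.

End dual_function.
End penalized_risk.

Theorem proposition8 (R : realType) (N n d : nat)
    (hN : (0 < N)%N) (hn : (0 < n)%N) (hd : (0 < d)%N)
    (p : 'rV[R]_N) (hp : prob_simplex R N p) (hp_gt0 : forall i, 0 < p 0 i)
    (z : 'I_N -> 'rV[R]_d) (loss : 'rV[R]_n -> 'rV[R]_d -> \bar R)
    (loss_Ny : forall i theta, loss theta (z i) != -oo%E)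
    (loss_lsc : forall i, lower_semicontinuous (fun theta => loss theta (z i)))
    (loss_convex : forall i, convex_efun (fun theta => loss theta (z i)))
    (loss_dom :
      \bigcap_(i in [set: 'I_N])
        effective_domain (fun theta => loss theta (z i)) !=set0)
    (phi : R -> \bar R) (phi_ge0 : forall t, (0 <= phi t)%E)
    (phi_lsc : lower_semicontinuous phi) (phi_convex : convex_efun phi)
    (phi_dom0 : effective_domain phi !=set0)
    (phi_dom : effective_domain phi `<=` [set t | 0 <= t])
    (phi1 : phi 1 = 0%E)
    (lambda0 : R) (hlambda0 : 0 < lambda0) :
  let alpha := divergence_penalty phi lambda0 p in
  let g := dual_loss phi lambda0 p loss z in
  [/\ (let g2 := fun x : 'rV[R]_n * R => g x.1 x.2 in
       [/\ proper_efun g2, lower_semicontinuous g2 & convex_efun g2]),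
      (forall theta, argmin (g theta) !=set0)
    & argmin (robust_loss loss z alpha) =
      argmin (fun theta => ereal_inf (range (g theta)))].
Proof.
move=> alpha g; split; first split.
- exact: dual_loss_proper.
- exact: dual_loss_lsc.
- exact: dual_loss_convex.
- by move=> theta; apply: dual_loss_argmin => //; exact: hp.2.
- by apply: argmin_robust_loss => //; exact: hp.2.
Qed.
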